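(* Let $f,g,F=f+g$ and Bregman distances with parameters be as in the context. Let $\overline x\in\overline{\mathbf X}_P$, $\overline F=F(\overline x)$, and suppose condition (H$_3$) holds at $\overline x$: there is $\delta>0$ such that $F(y)\le F(\overline x)$ whenever $y\in\overline{\mathbf X}_P$ and $\|y-\overline x\|\le\delta$. Suppose one of the following conditions holds: (i) the Bregman proximal error bound holds uniformly at $\overline x$, $\overline\epsilon<\min\{\frac mL,\frac m\rho\}$, and either $g$ is semi-convex with modulus $\rho$, or $g$ is uniformly prox-regular around $\overline x$ with parameters $\rho,\eta$ and every $x\in\mathfrak{B}(\overline x;\frac\eta2,\frac\nu N)$, with $N\ge\frac{2\overline\epsilon\nu}{m-\overline\epsilon L}\big/\left(\frac\eta2\right)^2$, satisfies Property (A); (ii) $\partial_PF$ is weakly metrically subregular at $\overline x$ for the zero vector $0$. Then the level-set subdifferential error bound holds at $\overline x$ with exponent $\gamma=1$.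
   Context: Assumptions on $f,g$: $f:\mathbb{R}^n\to(-\infty,\infty]$ is a proper lower semicontinuous (possibly nonconvex) function, differentiable on $\mathrm{dom} f$, with $\mathrm{dom} f$ convex and $\nabla f$ $L$-Lipschitz continuous on $\mathrm{dom} f$; $g:\mathbb{R}^n\to(-\infty,\infty]$ is proper, lower semicontinuous (possibly nonconvex and nonsmooth), continuous on $\mathrm{dom} g$, and $\mathrm{dom} g$ is convex; $F=f+g$ is level-bounded, i.e. $\{x: F(x)\le r\}$ is bounded (possibly empty) for every $r\in\mathbb{R}$. Bregman distances: the pairs $(D,\epsilon)$ considered satisfy: $D(x,y)=K(y)-[K(x)+\langle\nabla K(x),y-x\rangle]$ with $K:\mathbb{R}^n\to\mathbb{R}$ twice differentiable, strongly convex with modulus $m>0$, $\nabla K$ $M$-Lipschitz, and $0<\underline\epsilon\le\epsilon\le\overline\epsilon$ (constants common to all pairs). $T_{D,\epsilon}(x)=\arg\min_{y}\{\langle\nabla f(x),y-x\rangle+g(y)+\frac1\epsilon D(x,y)\}$. $\partial_P\psi(\bar x)=\{\xi:\exists \rho'>0,r>0 \text{ s.t. } \psi(x)\ge\psi(\bar x)+\langle\xi,x-\bar x\rangle-\rho'\|x-\bar x\|^2\ \forall x\in\mathbb{B}(\bar x;r)\}$ (proximal subdifferential; $\mathbb{B}$ open ball); $\partial_L$ is the limiting (Mordukhovich) subdifferential; $\overline{\mathbf X}_P=\{x:0\in\partial_PF(x)\}$. $\mathrm{dist}(x,C)=\inf_{z\in C}\|x-z\|$ ($=\infty$ if $C=\emptyset$),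 $[F\le\overline F]=\{x:F(x)\le\overline F\}$, $\mathfrak{B}(\overline x;\eta,\nu)=\mathbb{B}(\overline x;\eta)\cap\{x:\overline F<F(x)<\overline F+\nu\}$. Bregman proximal error bound at $\overline x$: there exist $\eta,\nu,c_4>0$ such that $\mathrm{dist}(x,\overline{\mathbf X}_P)\le c_4\,\mathrm{dist}(x,T_{D,\epsilon}(x))$ for all $x\in\mathfrak{B}(\overline x;\eta,\nu)$; uniformly means with constants the same for all pairs $(D,\epsilon)$ considered. Weak metric subregularity of $\partial_PF$ at $\overline x$ for $0$: there exist $\eta,\nu,c_5>0$ such that $c_5\,\mathrm{dist}(x,\overline{\mathbf X}_P)\le\mathrm{dist}(0,\partial_PF(x))$ for all $x\in\mathfrak{B}(\overline x;\eta,\nu)$. Level-set subdifferential error bound at $\overline x$ with exponent $\gamma$: there exist $\eta,\nu,c_3>0$ with $\mathrm{dist}^\gamma(x,[F\le\overline F])\le c_3\,\mathrm{dist}(0,\partial_PF(x))$ for all $x\in\mathfrak{B}(\overline x;\eta,\nu)$. $g$ is semi-convex with modulus $\rho>0$ if $g=h-\frac\rho2\|\cdot\|^2$ with $h:\mathbb{R}^n\to\mathbb{R}$ convex. $g$ is uniformly prox-regular around $\overline x$ with parameters $\rho\ge0,\eta>0$ if $g(x')\ge g(x)+\langle v,x'-x\rangle-\frac\rho2\|x'-x\|^2$ for all $x,x'\in\mathbb{B}(\overline x;\eta)$ and $v\in\partial_Lg(x)$. Property (A) at $x$: $F(t)\ge\overline F$ for all $t\in T_{D,\epsilon}(x)$.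 *)

(* Defs.v *)
From mathcomp Require Import all_boot all_order all_algebra.
From mathcomp Require Import all_classical all_reals all_analysis.

Set Implicit Arguments.
Unset Strict Implicit.
Unset Printing Implicit Defensive.

Import Order.TTheory GRing.Theory Num.Theory.
Import numFieldNormedType.Exports.

Local Open Scope classical_set_scope.
Local Open Scope ring_scope.

(* The library norm on ['rV[R]_n] is the sup norm. It induces the usual
   topology, bounded sets and differentiability, so the library notions are
   used for those; every norm, ball, distance and modulus below is Euclidean. *)
Section Euclidean.
Context {R : realType} {n : nat}.
Implicit Types (x y : 'rV[R]_n) (A : set 'rV[R]_n).

Definition dotp x y : R := \sum_(i < n) x 0 i * y 0 i.

Definition enorm x : R := Num.sqrt (dotp x x).

Definition eball x (r : R) : set 'rV[R]_n := [set y | enorm (y - x) < r].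

(* The infimum is taken in the extended reals, hence is +oo on the empty set. *)
Definition dist x A : \bar R := ereal_inf [set (enorm (x - z))%:E | z in A].

Definition elipschitz_on A (L : R) (G : 'rV[R]_n -> 'rV[R]_n) : Prop :=
  forall x y, A x -> A y -> enorm (G x - G y) <= L * enorm (x - y).

Definition grad (h : 'rV[R]_n -> R) x : 'rV[R]_n :=
  \row_(i < n) 'D_(delta_mx 0 i) h x.

Definition strongly_convex (m : R) (K : 'rV[R]_n -> R) : Prop :=
  forall x y (t : R), 0 <= t <= 1 ->
    K (t *: x + (1 - t) *: y) <=
      t * K x + (1 - t) * K y - m / 2 * (t * (1 - t)) * enorm (x - y) ^+ 2.

End Euclidean.

Section ExtendedRealFunctions.
Context {R : realType} {n : nat}.
Implicit Types (psi : 'rV[R]_n -> \bar R) (x xi : 'rV[R]_n).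

Definition dom psi : set 'rV[R]_n := [set x | (psi x < +oo)%E].

Definition proper psi : Prop := (forall x, (-oo < psi x)%E) /\ dom psi !=set0.

Definition level_bounded psi : Prop :=
  forall r : R, bounded_set [set x | (psi x <= r%:E)%E].

(* First-order expansion psi (x + v) = psi x + <grad, v> + o(v) over all small
   v, which forces psi to be finite around x. *)
Definition edifferentiable psi x : Prop :=
  (\forall y \near x, psi y \is a fin_num) /\ differentiable (fine \o psi) x.

Definition egrad psi x : 'rV[R]_n := grad (fine \o psi) x.

(* As usual, subdifferentials are empty at points where psi is not finite. *)
Definition prox_subdiff psi x : set 'rV[R]_n :=
  [set xi | psi x \is a fin_num /\
    exists rho r : R, [/\ 0 < rho, 0 < r & forall y, eball x r y ->
      (psi x + (dotp xi (y - x) - rho * enorm (y - x) ^+ 2)%:E <= psi y)%E]].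

Definition frechet_subdiff psi x : set 'rV[R]_n :=
  [set xi | psi x \is a fin_num /\
    forall e : R, 0 < e -> \forall y \near x,
      (psi x + (dotp xi (y - x) - e * enorm (y - x))%:E <= psi y)%E].

Definition limiting_subdiff psi x : set 'rV[R]_n :=
  [set xi | psi x \is a fin_num /\
    exists u v : nat -> 'rV[R]_n,
      [/\ u @ \oo --> x, psi \o u @ \oo --> psi x,
          (forall k, frechet_subdiff psi (u k) (v k)) & v @ \oo --> xi]].

Definition prox_critical psi : set 'rV[R]_n := [set x | prox_subdiff psi x 0].

Definition semiconvex psi (rho : R) : Prop :=
  0 < rho /\ exists2 h : 'rV[R]_n -> R,
    convex_function [set: convex_lmodType 'rV[R]_n] h &
    forall x, psi x = (h x - rho / 2 * enorm x ^+ 2)%:E.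

Definition uniformly_prox_regular psi (xbar : 'rV[R]_n) (rho eta : R) : Prop :=
  [/\ 0 <= rho, 0 < eta & forall x x' v,
      eball xbar eta x -> eball xbar eta x' -> limiting_subdiff psi x v ->
      (psi x + (dotp v (x' - x) - rho / 2 * enorm (x' - x) ^+ 2)%:E
         <= psi x')%E].

End ExtendedRealFunctions.

Section ErrorBounds.
Context {R : realType} {n : nat}.
Implicit Types (F : 'rV[R]_n -> \bar R) (xbar : 'rV[R]_n).

Definition sublevel F (a : \bar R) : set 'rV[R]_n := [set x | (F x <= a)%E].

Definition upper_nbhs F xbar (eta nu : R) : set 'rV[R]_n :=
  [set x | eball xbar eta x /\ (F xbar < F x < F xbar + nu%:E)%E].

Definition condition_H3 F xbar : Prop :=
  exists2 delta : R, 0 < delta &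
    forall y, prox_critical F y -> enorm (y - xbar) <= delta ->
      (F y <= F xbar)%E.

Definition weakly_metrically_subregular F xbar : Prop :=
  exists eta nu c : R, [/\ 0 < eta, 0 < nu, 0 < c &
    forall x, upper_nbhs F xbar eta nu x ->
      (c%:E * dist x (prox_critical F) <= dist 0 (prox_subdiff F x))%E].

Definition level_set_error_bound F xbar (gamma : R) : Prop :=
  exists eta nu c : R, [/\ 0 < eta, 0 < nu, 0 < c &
    forall x, upper_nbhs F xbar eta nu x ->
      (dist x (sublevel F (F xbar)) `^ gamma
         <= c%:E * dist 0 (prox_subdiff F x))%E].

End ErrorBounds.

Section Bregman.
Context {R : realType} {n : nat}.
Local Notation distance := ('rV[R]_n -> 'rV[R]_n -> R).
Implicit Types (f g : 'rV[R]_n -> \bar R) (xbar : 'rV[R]_n).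
Implicit Types (D : distance) (pairs : set (distance * R)).

Definition bregman_distance (m M : R) D : Prop :=
  exists K : 'rV[R]_n -> R,
    [/\ forall x, differentiable K x /\ differentiable (grad K) x,
        strongly_convex m K,
        elipschitz_on setT M (grad K) &
        forall x y, D x y = K y - (K x + dotp (grad K x) (y - x))].

Definition admissible_pairs (m M eps_lo eps_up : R) pairs : Prop :=
  pairs !=set0 /\
  forall D eps, pairs (D, eps) ->
    bregman_distance m M D /\ eps_lo <= eps <= eps_up.

Definition bregman_objective f g D (eps : R) (x y : 'rV[R]_n) : \bar R :=
  ((dotp (egrad f x) (y - x))%:E + g y + (eps^-1 * D x y)%:E)%E.

Definition bregman_prox f g D (eps : R) (x : 'rV[R]_n) : set 'rV[R]_n :=
  [set t | forall y,
    (bregman_objective f g D eps x t <= bregman_objective f g D eps x y)%E].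

Definition uniform_bregman_prox_error_bound f g pairs xbar : Prop :=
  exists eta nu c : R, [/\ 0 < eta, 0 < nu, 0 < c &
    forall D eps, pairs (D, eps) ->
    forall x, upper_nbhs (f \+ g)%E xbar eta nu x ->
      (dist x (prox_critical (f \+ g)%E)
         <= c%:E * dist x (bregman_prox f g D eps x))%E].

Definition property_A f g pairs xbar (x : 'rV[R]_n) : Prop :=
  forall D eps, pairs (D, eps) ->
  forall t, bregman_prox f g D eps x t ->
    ((f \+ g) xbar <= (f \+ g) t)%E.

Definition assumption_f f (L : R) : Prop :=
  [/\ proper f, lower_semicontinuous f,
      forall x, dom f x -> edifferentiable f x,
      convex_set (dom f : set (convex_lmodType 'rV[R]_n)) &
      elipschitz_on (dom f) L (egrad f)].

Definition assumption_g g : Prop :=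
  [/\ proper g, lower_semicontinuous g, {within dom g, continuous g} &
      convex_set (dom g : set (convex_lmodType 'rV[R]_n))].

(* The quotients are extended-real: m / 0 = +oo, which matters for L = 0 and
   rho = 0. *)
Definition condition_i f g (L m eps_up : R) pairs xbar : Prop :=
  uniform_bregman_prox_error_bound f g pairs xbar /\
  exists rho : R,
    (eps_up%:E < Order.min (m%:E / L%:E) (m%:E / rho%:E))%E /\
    (semiconvex g rho \/
     exists eta nu N : R,
       [/\ uniformly_prox_regular g xbar rho eta,
           0 < nu,
           2 * eps_up * nu / (m - eps_up * L) / (eta / 2) ^+ 2 <= N &
           forall x, upper_nbhs (f \+ g)%E xbar (eta / 2) (nu / N) x ->
             property_A f g pairs xbar x]).

End Bregman.

(* Main.v *)
Require Import Defs.
From mathcomp Require Import all_boot all_order all_algebra.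
From mathcomp Require Import all_classical all_reals all_analysis.
From mathcomp Require Import ring lra.
Import Order.TTheory GRing.Theory Num.Theory.
Import numFieldNormedType.Exports.
Local Open Scope classical_set_scope.
Local Open Scope ring_scope.

(** Write [X] for the set of proximal critical points of [F = f + g]. Near
    [xbar], the critical points that can compete for the distance from [x] lie
    in the ball where (H3) puts them into the sublevel set of [F xbar], while
    [xbar] itself does better than all the others; hence the distance from [x]
    to the sublevel set is at most the distance to [X]
    ([dist_sublevel_le_critical]). It therefore suffices to bound the distance
    to [X] by a multiple of the distance from [0] to the proximal
    subdifferential of [F] at [x]. Weak metric subregularity is such a bound.

    Under condition (i), the error bound already controls the distance to [X]
    by the distance from [x] to the Bregman proximal set, so the point is to
    show [|t - x| <= k |xi|] whenever [xi] is a proximal subgradient of [F] at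
    [x] and [t] is a Bregman proximal point of [x]. A single pair [(D, eps)] is
    enough for this. By the sum rule [v := xi - grad f x] is a proximal
    subgradient of [g] ([prox_subdiff_sum]). If [v] supports [g] at [t] up to
    the quadratic error [rho / 2 |t - x|^2], then optimality of [t] against
    [x], together with [D x t >= m / 2 |t - x|^2], leaves
    [(m / eps - rho) / 2 |t - x|^2 <= - <xi, t - x>], and Cauchy-Schwarz
    concludes ([prox_residual_le]). For semi-convex [g] the quadratic support
    is global ([semiconvex_prox_subdiff]). For prox-regular [g] it holds only
    in a ball around [xbar], and [t] is brought into that ball by the sufficient
    decrease [F t + (m / eps - L) / 2 |t - x|^2 <= F x]
    ([bregman_sufficient_decrease]): Property (A) gives [F xbar <= F t], and
    [F x - F xbar] is small.

    Two facts support the argument. First, a proximal point must exist, as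
    otherwise the distance to the proximal set is infinite and the error bound
    is void; the sufficient decrease places the sublevel set of the objective
    inside a level set of [F], which is bounded, so the lower semicontinuous
    objective attains its minimum ([bregman_prox_nonempty]). Second, the
    descent inequality has to be available at points about which only
    [g t < +oo] is known; this is legitimate because the hypotheses on [f] force
    its domain to be the whole space ([smooth_dom_full]). *)

(** * Euclidean inner product and norm *)

Section EuclideanSpace.
Context {R : realType} {n : nat}.
Implicit Types (x y z u v : 'rV[R]_n) (a r s : R).

Lemma dotpC x y : dotp x y = dotp y x.
Proof. by apply: eq_bigr => i _; rewrite mulrC. Qed.

Lemma dotpDl x y z : dotp (x + y) z = dotp x z + dotp y z.
Proof. by rewrite -big_split; apply: eq_bigr => i _; rewrite mxE mulrDl. Qed.

Lemma dotpZl a x y : dotp (a *: x) y = a * dotp x y.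
Proof.
by rewrite /dotp mulr_sumr; apply: eq_bigr => i _; rewrite mxE mulrA.
Qed.

Lemma dotpNl x y : dotp (- x) y = - dotp x y.
Proof. by rewrite -scaleN1r dotpZl mulN1r. Qed.

Lemma dotpDr x y z : dotp x (y + z) = dotp x y + dotp x z.
Proof. by rewrite !(dotpC x) dotpDl. Qed.

Lemma dotpZr a x y : dotp x (a *: y) = a * dotp x y.
Proof. by rewrite !(dotpC x) dotpZl. Qed.

Lemma dotpNr x y : dotp x (- y) = - dotp x y.
Proof. by rewrite !(dotpC x) dotpNl. Qed.

Definition dotpE := (dotpDl, dotpDr, dotpNl, dotpNr, dotpZl, dotpZr).

Lemma dotp_ge0 x : 0 <= dotp x x.
Proof. by apply: sumr_ge0 => i _; rewrite -expr2 sqr_ge0. Qed.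

Lemma enorm_ge0 x : 0 <= enorm x.
Proof. exact: sqrtr_ge0. Qed.

Lemma sqr_enorm x : enorm x ^+ 2 = dotp x x.
Proof. exact: sqr_sqrtr (dotp_ge0 x). Qed.

Lemma dotp_eq0 x : dotp x x = 0 -> x = 0.
Proof.
move=> /eqP; rewrite psumr_eq0; last by move=> i _; rewrite -expr2 sqr_ge0.
move=> /allP x0; apply/rowP => i; rewrite mxE.
by have := x0 i (mem_index_enum _); rewrite /= mulf_eq0 orbb => /eqP.
Qed.

Lemma enorm0 : enorm (0 : 'rV[R]_n) = 0.
Proof. by rewrite /enorm /dotp big1 ?sqrtr0// => i _; rewrite mxE mul0r. Qed.

Lemma enormN x : enorm (- x) = enorm x.
Proof. by rewrite /enorm !dotpE opprK. Qed.

Lemma enormZ a x : 0 <= a -> enorm (a *: x) = a * enorm x.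
Proof.
move=> a0; apply/eqP; rewrite -(@eqrXn2 _ 2) ?mulr_ge0 ?enorm_ge0//.
by rewrite exprMn !sqr_enorm !dotpE expr2 mulrA.
Qed.

Lemma enorm_distC x y : enorm (x - y) = enorm (y - x).
Proof. by rewrite -enormN opprB. Qed.

(** Expand [0 <= |(|y| x - |x| y)|^2] and divide by [2 |x| |y|]. *)
Lemma cauchy_schwarz x y : dotp x y <= enorm x * enorm y.
Proof.
have [->|x0] := eqVneq x 0.
  by rewrite enorm0 mul0r -(scale0r 0) dotpZl mul0r.
have [->|y0] := eqVneq y 0.
  by rewrite enorm0 mulr0 -(scale0r 0) dotpZr mul0r.
have nz z : z != 0 -> 0 < enorm z.
  move=> z0; rewrite lt_neqAle enorm_ge0 andbT; apply: contra_neq z0 => z0.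
  by apply: dotp_eq0; rewrite -sqr_enorm -z0 expr0n.
have := dotp_ge0 (enorm y *: x - enorm x *: y).
rewrite !dotpE (dotpC y x) -!sqr_enorm => le0.
rewrite -subr_ge0 -(pmulr_rge0 _ (mulr_gt0 (nz _ x0) (nz _ y0))).
by move: le0; nra.
Qed.

Lemma enormD x y : enorm (x + y) <= enorm x + enorm y.
Proof.
rewrite -(@ler_pXn2r _ 2) ?nnegrE ?addr_ge0 ?enorm_ge0//.
rewrite sqr_enorm !dotpE (dotpC y x) -!sqr_enorm.
by have := cauchy_schwarz x y; nra.
Qed.

Lemma enorm_triangle x y z : enorm (x - z) <= enorm (x - y) + enorm (y - z).
Proof. by rewrite -[X in enorm X](subrKA y) enormD. Qed.

Lemma dotp_continuous (p q : 'rV[R]_n -> 'rV[R]_n) :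
  continuous p -> continuous q -> continuous (fun y => dotp (p y) (q y)).
Proof.
move=> cp cq; apply: continuous_big => [|i _]; first exact: add_continuous.
have c (w : 'rV[R]_n -> 'rV[R]_n) : continuous w ->
    continuous (fun y => w y 0 i).
  move=> cw y; apply: (@continuous_comp _ _ _ w (fun y => y 0 i)).
    exact: cw.
  exact: (@coord_continuous R 1 n 0 i (w y)).
move=> y; apply: cvgM; [exact: nbhs_filter|exact: (c _ cp y)|exact: (c _ cq y)].
Qed.

Lemma subr_continuous x : continuous (fun y => y - x).
Proof.
move=> y; apply: (@continuousB R 'rV[R]_n 'rV[R]_n (fun y => y) (fun=> x) y).
  exact: cvg_id.
by apply: cst_continuous.
Qed.

(** Links the Euclidean balls to the topology, which comes from the sup norm. *)
Lemma nbhs_eball x r : 0 < r -> \forall y \near x, eball x r y.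
Proof.
move=> r0; rewrite /eball /=.
have cd : continuous (fun y => dotp (y - x) (y - x)).
  by apply: dotp_continuous; exact: subr_continuous.
have lt0 : dotp (x - x) (x - x) < r ^+ 2.
  by rewrite subrr -sqr_enorm enorm0 expr0n exprn_gt0.
have := @cvgr_lt R _ (nbhs x) (nbhs_filter x) _ _ (cd x) _ lt0.
apply: filterS => y; rewrite -sqr_enorm.
by rewrite ltr_pXn2r// nnegrE ?enorm_ge0// ltW.
Qed.

End EuclideanSpace.

(** * Differential calculus along segments *)

Section Calculus.
Context {R : realType} {n : nat}.
Implicit Types (h : 'rV[R]_n -> R) (x y z u v : 'rV[R]_n) (a r s : R).

Lemma derive_grad h x v : differentiable h x -> 'D_v h x = dotp (grad h x) v.
Proof.
move=> dh; rewrite deriveE// [in LHS](row_sum_delta v) linear_sum.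
by apply: eq_bigr => i _; rewrite linearZ /= mxE deriveE// mulrC.
Qed.

Lemma is_derive_line h x v s : differentiable h (x + s *: v) ->
  is_derive s 1 (fun t : R => h (x + t *: v)) (dotp (grad h (x + s *: v)) v).
Proof.
move=> dh; rewrite -derive_grad//.
have := @diff_derivable _ _ _ _ _ v dh.
rewrite /derivable /derive.
set q := (X in cvg (X @ _)) => qcvg.
have qE : q = (fun k : R => k^-1 *: (((fun t : R => h (x + t *: v)) \o shift s)
   (k *: 1) - h (x + s *: v))).
  apply/funext => k; rewrite /q /=; congr (_ *: (h _ - _)).
  by rewrite scaler1 scalerDl addrCA.
by split; rewrite /derivable /derive -qE.
Qed.

(** Subtracting [t <grad h x, v> + t^2 L / 2 |v|^2] from [h (x + t v)] leaves a
    function of [t] whose derivative is nonpositive by the Lipschitz bound,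
    hence a nonincreasing one. Applying the mean value theorem to [h] itself
    would give the constant [L] instead of [L / 2], and sufficient decrease
    would then need [eps < m / (2 L)]. *)
Lemma descent_segment h (L : R) x y :
  (forall s, 0 <= s <= 1 -> differentiable h (x + s *: (y - x))) ->
  (forall s, 0 <= s <= 1 -> enorm (grad h (x + s *: (y - x)) - grad h x) <=
     L * enorm (x + s *: (y - x) - x)) ->
  h y <= h x + dotp (grad h x) (y - x) + L / 2 * enorm (y - x) ^+ 2.
Proof.
set v := y - x => dh Lh.
pose phi (t : R) := h (x + t *: v) - (t * dotp (grad h x) v
  + t ^+ 2 * (L / 2 * enorm v ^+ 2)).
have dphi (t : R) : 0 <= t <= 1 -> is_derive t 1 phi
    (dotp (grad h (x + t *: v)) v - (dotp (grad h x) v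
      + t * (L * enorm v ^+ 2))).
  move=> t01; have dl := is_derive_line _ _ _ _ (dh _ t01).
  apply: is_derive_eq.
  by rewrite !(scaler0, add0r, scaler1) /GRing.scale /=; field.
suff : phi 1 <= phi 0.
  rewrite /phi scale1r scale0r addr0 mul0r expr0n mul0r !mul1r expr1n mul1r.
  by rewrite /v (addrC x) subrK; lra.
apply: (@ler0_derive1_le_cc _ phi 0 1) => //; rewrite ?in_itv/= ?ler01 ?lexx//.
- move=> t; rewrite in_itv/= => /andP[t0 t1].
  by apply: (@ex_derive _ _ _ _ _ _ _ (dphi t _)); rewrite !ltW.
- move=> t; rewrite in_itv/= => /andP[/ltW t0 /ltW t1].
  have t01 : 0 <= t <= 1 by rewrite t0.
  rewrite derive1E (@derive_val _ _ _ _ _ _ _ (dphi t t01)).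
  have := Lh t t01; rewrite [x + _ - x]addrAC subrr add0r enormZ// => Lv.
  have := cauchy_schwarz (grad h (x + t *: v) - grad h x) v.
  rewrite dotpDl dotpNl => cs.
  have := ler_wpM2r (enorm_ge0 v) Lv; lra.
- apply: derivable_within_continuous => t; rewrite in_itv/= => t01.
  exact: (@ex_derive _ _ _ _ _ _ _ (dphi t t01)).
Qed.

(** Passage to the limit [s -> 0] after division by a step [s]. *)
Lemma le_of_small_slope a b (c r : R) : 0 < r ->
  (forall s, 0 < s -> s < r -> a <= b + s * c) -> a <= b.
Proof.
move=> r0 H; rewrite leNgt; apply/negP => ba.
(* With this step, [s * c] is at most half the gap [a - b]. *)
pose s := Num.min (r / 2) ((a - b) / 2 / (1 + `|c|)).
have c1 : 0 < 1 + `|c| by rewrite ltr_wpDr.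
have s0 : 0 < s.
  by rewrite lt_min !divr_gt0 ?subr_gt0.
have sr : s < r by rewrite gt_min; apply/orP; left; lra.
have := H s s0 sr.
have : s * (1 + `|c|) <= (a - b) / 2.
  by rewrite -ler_pdivlMr// ge_min lexx orbT.
have := ler_norm (s * c); rewrite normrM (gtr0_norm s0).
nra.
Qed.

(** Strong convexity bounds the difference quotient of
    [t |-> h (x + t v) - m / 2 t^2 |v|^2] on [0 < t < 1] by
    [h y - h x - m / 2 |v|^2], and this quotient tends to [<grad h x, v>]: the
    term in [t^2] is there to absorb the part of the modulus that depends on
    [t]. *)
Lemma strongly_convex_grad h (m : R) x y : strongly_convex m h ->
  differentiable h x ->
  h x + dotp (grad h x) (y - x) + m / 2 * enorm (y - x) ^+ 2 <= h y.
Proof.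
move=> sch dh; set v := y - x.
have dh0 : differentiable h (x + 0 *: v) by rewrite scale0r addr0.
have := is_derive_line _ _ _ _ dh0; rewrite scale0r addr0 => dl.
have dcv : is_derive (0 : R) 1 (fun t : R => h (x + t *: v) -
    t ^+ 2 * (m / 2 * enorm v ^+ 2)) (dotp (grad h x) v).
  apply: is_derive_eq.
  by rewrite /GRing.scale /=; ring.
have [dc dv] := dcv.
suff : dotp (grad h x) v <= h y - h x - m / 2 * enorm v ^+ 2 by lra.
rewrite -dv /derive.
move: dc; rewrite /derivable; set q := (X in cvg (X @ _)) => qcvg.
rewrite leNgt; apply/negP => /(cvgr_gt _ qcvg) q_gt.
have [e /= e0 He] := q_gt.
(* A step inside both the neighbourhood [He] and the unit segment. *)
pose s := Num.min (e / 2) (1 / 2).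
have s0 : 0 < s by rewrite lt_min !divr_gt0.
have s1 : s < 1 by rewrite gt_min; apply/orP; right; lra.
have se : s < e by rewrite gt_min; apply/orP; left; lra.
have := He s; rewrite /= sub0r normrN gtr0_norm// => /(_ se (lt0r_neq0 s0)).
rewrite /q /= addr0 scale0r addr0 expr0n mul0r subr0 [s%:A]mulr1.
have := sch y x s; rewrite (ltW s0) (ltW s1) => /(_ isT).
have -> : s *: y + (1 - s) *: x = x + s *: v.
  by rewrite scalerBl scale1r scalerBr addrCA addrA.
move=> scs; rewrite ltNge => /negP; apply.
rewrite /GRing.scale /= mulrC ler_pdivrMr//.
by move: scs; rewrite -/v; nra.
Qed.

End Calculus.

(** * Minimization of lower semicontinuous functions *)

Section LowerSemicontinuous.
Context {R : realType} {n : nat}.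
Implicit Types (phi g : 'rV[R]_n -> \bar R) (x y : 'rV[R]_n).

Lemma closed_sublevel phi (a : R) : lower_semicontinuous phi ->
  closed [set x | (phi x <= a%:E)%E].
Proof.
move=> /lower_semicontinuousP lphi.
rewrite (_ : [set x | _] = ~` [set x | (a%:E < phi x)%E]).
  exact/open_closedC/lphi.
by apply/seteqP; split => x /=; rewrite leNgt => /negP.
Qed.

Lemma lower_semicontinuousD g (c : 'rV[R]_n -> R) :
  lower_semicontinuous g -> continuous c ->
  lower_semicontinuous (fun y => g y + (c y)%:E)%E.
Proof.
move=> lg cc x a; rewrite -lteBlDr// -EFinB => ag.
have [b ab bg] : exists2 b : R, a - c x < b & (b%:E < g x)%E.
  move: ag; case: (g x) => [r| |] //.
  - rewrite lte_fin => ar; exists ((a - c x + r) / 2); rewrite ?lte_fin; lra.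
  - by move=> _; exists (a - c x + 1); rewrite ?ltry//; lra.
have [V Vx Vg] := lg x b bg.
have ac : a - b < c x by lra.
have Wx := @cvgr_gt R _ (nbhs x) (nbhs_filter x) _ _ (cc x) _ ac.
exists (V `&` [set y | a - b < c y]); first exact: filterI.
move=> y [/Vg bgy /= acy].
have -> : a%:E = (b%:E + (a - b)%:E)%E by rewrite -EFinD addrC subrK.
by apply: lteD; rewrite ?lte_fin.
Qed.

Lemma seq_min (T : eqType) (psi : T -> \bar R) (s : seq T) : s != [::] ->
  exists2 z, z \in s & forall y : T, y \in s -> (psi z <= psi y)%E.
Proof.
elim: s => // y [|y' s] IH _.
  by exists y => [|z]; rewrite inE// => /eqP->.
have [//|z zs zmin] := IH.
have [yz|zy] := leP (psi y) (psi z).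
  exists y; first exact: mem_head.
  move=> u; rewrite inE => /predU1P[->//|/zmin]; exact: le_trans.
exists z; first by rewrite inE zs orbT.
by move=> u; rewrite inE => /predU1P[->|/zmin//]; exact: ltW.
Qed.

(** The sublevel set at [x] is compact. If no point were a minimizer, the open
    sets [phi y < phi z] would cover it; a point of least value among the
    finitely many indices of a subcover lies in none of them. *)
Lemma lower_semicontinuous_attains_min phi x :
  lower_semicontinuous phi -> (forall y, (-oo < phi y)%E) ->
  phi x \is a fin_num -> bounded_set [set y | (phi y <= phi x)%E] ->
  exists t, forall y, (phi t <= phi y)%E.
Proof.
move=> lphi phiNy phix bdd; set A := [set y | (phi y <= phi x)%E] in bdd *.
have finA y : A y -> phi y \is a fin_num.
  move=> Ay; rewrite fin_numE -ltey (le_lt_trans Ay) ?ltey_eq ?phix// andbT.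
  by rewrite -ltNye.
have cA : compact A.
  apply: bounded_closed_compact => //.
  by rewrite /A -(fineK phix); exact: closed_sublevel.
apply: contrapT => /forallNP nomin.
move: cA; rewrite compact_cover => /(_ 'rV[R]_n A
  (fun y => [set z | (phi y < phi z)%E])).
case.
- move=> y Ay; rewrite -(fineK (finA y Ay)).
  by move/lower_semicontinuousP : lphi; exact.
- move=> y Ay.
  have /existsNP[z /negP] := nomin y; rewrite -ltNge => zy.
  by exists z => //; exact: le_trans (ltW zy) Ay.
move=> D DA Acov.
have D0 : finmap.enum_fset D != [::].
  have [i iD _] := Acov x (lexx _).
  have {}iD : i \in finmap.enum_fset D := iD.
  by apply: contraTneq iD => ->.
have [z zD zmin] := seq_min _ phi _ D0.
have /DA := zD; rewrite inE => Az.
have [i iD /=] := Acov z Az.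
by rewrite ltNge zmin.
Qed.

End LowerSemicontinuous.

(** * Smooth functions with Lipschitz gradient on their domain *)

Section SmoothPart.
Context {R : realType} {n : nat}.
Implicit Types (f : 'rV[R]_n -> \bar R) (x y : 'rV[R]_n).

Lemma convex_set_segment (A : set (convex_lmodType 'rV[R]_n)) x y (s : R) :
  convex_set A -> A x -> A y -> 0 <= s <= 1 -> A (x + s *: (y - x)).
Proof.
move=> cA Ax Ay /andP[s0 s1].
have := cA y x (Itv01 s0 s1); rewrite !inE => /(_ Ay Ax).
rewrite (_ : x + s *: (y - x) = s *: y + (1 - s) *: x)//.
by rewrite scalerBl scale1r scalerBr addrCA addrA.
Qed.

Lemma descent_dom f (L : R) x y : assumption_f f L -> dom f x -> dom f y ->
  fine (f y) <= fine (f x) + dotp (egrad f x) (y - x)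
     + L / 2 * enorm (y - x) ^+ 2.
Proof.
move=> [_ _ df cf Lf] fx fy; apply: (descent_segment (fine \o f)) => s s01.
  by apply: (df _ _).2; exact: convex_set_segment.
by apply: Lf => //; exact: convex_set_segment.
Qed.

(** The domain is open, since differentiability at a point includes finiteness
    around it. Along a segment issued from a point of the domain, the descent
    inequality bounds [f] by a constant on the part that meets the domain, and
    lower semicontinuity carries this bound to the limit, so that part is also
    closed; the segment being connected, it stays in the domain. *)
Lemma smooth_dom_full f (L : R) y : 0 <= L -> assumption_f f L -> dom f y.
Proof.
move=> L0 hf; have [[_ [x fx]] lf df cf _] := hf.
pose v := y - x.
have cline : continuous (fun s : R => x + s *: v).
  move=> s; apply: (@continuousD R 'rV[R]_n R (fun=> x) (fun s => s *: v) s).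
    by apply: cst_continuous.
  exact: scalel_continuous.
pose C := fine (f x) + `|dotp (egrad f x) v| + L / 2 * enorm v ^+ 2.
pose S : set R := [set s | (f (x + s *: v)%R <= C%:E)%E].
have dom_bound s : 0 <= s <= 1 -> dom f (x + s *: v) -> S s.
  move=> /andP[s0 s1] fs.
  have fin_fs := nbhs_singleton (df _ fs).1.
  rewrite /S /= -(fineK fin_fs) lee_fin.
  apply: le_trans (descent_dom _ _ _ _ hf fx fs) _.
  rewrite [x + _ - x]addrAC subrr add0r dotpZr enormZ// exprMn.
  apply: lerD; first apply: lerD => //.
    by apply: le_trans (ler_norm _) _; rewrite normrM ger0_norm// ler_piMl.
  by rewrite ler_wpM2l ?divr_ge0// ler_piMl ?sqr_ge0// expr_le1.
have S_dom s : S s -> dom f (x + s *: v).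
  by move=> Ss; exact: le_lt_trans Ss (ltry _).
have odom : open [set s : R | dom f (x + s *: v)].
  apply: (@open_comp _ _ (fun s : R => x + s *: v) (dom f)).
    by move=> s _; exact: cline.
  rewrite openE => z fz; rewrite /interior /=.
  by apply: filterS (df _ fz).1 => w; rewrite /dom /= ltey_eq => ->.
have cS : closed S.
  apply: (@preimage_closed _ _ (fun s : R => x + s *: v)
    [set z | (f z <= C%:E)%E]).
    by move=> s _; exact: cline.
  exact: closed_sublevel.
have domE : `[0, 1]%classic `&` S =
    `[0, 1]%classic `&` [set s : R | dom f (x + s *: v)].
  apply/seteqP; split=> s [s01 Ss]; split => //; first exact: S_dom.
  by apply: dom_bound => //; move: s01; rewrite /= in_itv.
have S01 : `[0, 1]%classic `&` S = `[0, 1]%classic.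
  apply: segment_connected; [ |
    by exists [set s : R | dom f (x + s *: v)] | by exists S].
  exists 0; rewrite domE; split; first by rewrite /= in_itv/= lexx ler01.
  by rewrite /= scale0r addr0.
have [_ /S_dom] : (`[0, 1]%classic `&` S) 1.
  by rewrite S01 /= in_itv/= ler01 lexx.
by rewrite scale1r addrC subrK.
Qed.

Lemma smooth_fin_num f (L : R) y : 0 <= L -> assumption_f f L ->
  f y \is a fin_num.
Proof.
move=> L0 hf; have [_ _ df _ _] := hf.
exact: (nbhs_singleton (df y (smooth_dom_full _ _ _ L0 hf)).1).
Qed.

End SmoothPart.

(** * Proximal subgradients *)

Section ProximalSubdifferential.
Context {R : realType} {n : nat}.
Implicit Types (f g : 'rV[R]_n -> \bar R) (x y v xi : 'rV[R]_n).

(** [f] lies below its quadratic model at [x], so subtracting it from a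
    quadratic minorant of [F] leaves one of [g], with curvature increased by
    [L / 2]. *)
Lemma prox_subdiff_sum f g (L : R) x xi : 0 <= L -> assumption_f f L ->
  (forall y, (-oo < g y)%E) -> prox_subdiff (f \+ g)%E x xi ->
  prox_subdiff g x (xi - egrad f x).
Proof.
move=> L0 hf gNy [Ffin [rho [r [rho0 r0 Fge]]]].
have ff y : f y \is a fin_num by exact: smooth_fin_num L0 hf.
have gfin : g x \is a fin_num by move: Ffin; rewrite /= fin_numD ff.
split=> //; exists (rho + L / 2), r; split => //; first by lra.
move=> y /Fge /=.
have := descent_dom f L x y hf (smooth_dom_full _ _ _ L0 hf)
  (smooth_dom_full _ _ _ L0 hf).
have := gNy y; case: (g y) => [gy| |] // _; last by rewrite leey.
rewrite -(fineK (ff x)) -(fineK (ff y)) -(fineK gfin).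
rewrite -!EFinD !lee_fin /= dotpDl dotpNl; lra.
Qed.

(** On a small ball the quadratic error is below any linear one, which makes
    [v] a Frechet subgradient; constant sequences do the rest. *)
Lemma prox_subdiff_limiting g x v :
  prox_subdiff g x v -> limiting_subdiff g x v.
Proof.
move=> [gfin [rho [r [rho0 r0 gge]]]]; split => //.
exists (fun=> x), (fun=> v); split; try exact: cvg_cst.
move=> _; split => // e e0.
have re : 0 < Num.min r (e / rho) by rewrite lt_min r0 divr_gt0.
apply: filterS (nbhs_eball x _ re) => y.
rewrite /eball /= lt_min => /andP[yr ye].
apply: le_trans (gge y yr); rewrite leeD2l// lee_fin lerD2l lerN2.
rewrite expr2 mulrA ler_wpM2r ?enorm_ge0//.
by rewrite mulrC -ler_pdivlMr// ltW.
Qed.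

(** Adding [rho / 2 |.|^2] turns the local minorant of [g] at [x] into an affine
    minorant of the convex function [h] near [x], up to an error quadratic in
    the distance. At [x + s (y - x)] this error is of order [s^2], while
    convexity bounds [h] there by the chord; dividing by [s] and letting [s]
    tend to [0] removes the error and makes the affine minorant global. *)
Lemma semiconvex_prox_subdiff g (rho : R) x y v : semiconvex g rho ->
  prox_subdiff g x v ->
  (g x + (dotp v (y - x) - rho / 2 * enorm (y - x) ^+ 2)%:E <= g y)%E.
Proof.
move=> [_ [h hconv gE]] [_ [rho' [r [rho'0 r0 gge]]]].
have [d dE yE] : exists2 d, d = y - x & y = x + d.
  by exists (y - x) => //; rewrite addrC subrK.
rewrite -dE !gE -EFinD lee_fin.
pose q := (rho / 2 - rho') * enorm d ^+ 2.
suff : h x + dotp v d + rho * dotp x d <= h y.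
  by rewrite yE !sqr_enorm !dotpE (dotpC d x); lra.
(* Steps below [r / (1 + |d|)] stay in the ball, even if [d = 0]. *)
have d1 : 0 < 1 + enorm d by rewrite ltr_wpDr ?enorm_ge0.
apply: (@le_of_small_slope _ _ _ (- q) (Num.min 1 (r / (1 + enorm d)))).
  by rewrite lt_min ltr01 divr_gt0.
move=> s s0; rewrite lt_min => /andP[s1 sr].
have sd : eball x r (x + s *: d).
  rewrite /eball /= [x + _ - x]addrAC subrr add0r enormZ ?ltW//.
  move: sr; rewrite ltr_pdivlMr//; nra.
have := gge _ sd; rewrite !gE -EFinD lee_fin [x + _ - x]addrAC subrr add0r.
rewrite dotpZr (enormZ _ _ (ltW s0)) exprMn.
rewrite !sqr_enorm !dotpE (dotpC d x) => ge_s.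
have := hconv (Itv01 (ltW s0) (ltW s1)) y x.
rewrite !inE => /(_ I I).
rewrite [X in h X <= _](_ : _ = x + s *: d); last first.
  by rewrite dE scalerBr [RHS]addrCA -{2}(scale1r x) -scalerBl.
rewrite convRE /= => le_s.
rewrite -(ler_pM2l s0).
move: ge_s le_s; rewrite /q sqr_enorm /unstable.onem.
lra.
Qed.

End ProximalSubdifferential.

(** * Bregman proximal points *)

Section BregmanProx.
Context {R : realType} {n : nat}.
Implicit Types (f g : 'rV[R]_n -> \bar R) (x y t v xi : 'rV[R]_n).
Implicit Types (D : 'rV[R]_n -> 'rV[R]_n -> R).

Lemma bregman_ge D (m M : R) x y : bregman_distance m M D ->
  m / 2 * enorm (y - x) ^+ 2 <= D x y.
Proof.
move=> [K [dK cK _ ->]].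
by have := strongly_convex_grad K m x y cK (dK x).1; lra.
Qed.

Lemma bregman_self D (m M : R) x : bregman_distance m M D -> D x x = 0.
Proof.
move=> [K [_ _ _ ->]].
by rewrite subrr -(scale0r 0) dotpZr mul0r addr0 subrr.
Qed.

Lemma bregman_continuous D (m M : R) x : bregman_distance m M D ->
  continuous (D x).
Proof.
move=> [K [dK _ _ DE]] y.
rewrite (_ : D x = fun y => K y - (K x + dotp (grad K x) (y - x))); last first.
  by apply/funext => z; rewrite DE.
have cdot : continuous (fun y => dotp (grad K x) (y - x)).
  apply: dotp_continuous; last exact: subr_continuous.
  by move=> z; apply: cst_continuous.
apply: (@continuousB R R 'rV[R]_n K (fun y => K x + dotp (grad K x) (y - x)) y).
  exact: differentiable_continuous (dK y).1.
apply: (@continuousD R R 'rV[R]_n (fun=> K x)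
  (fun y => dotp (grad K x) (y - x)) y).
  by apply: cst_continuous.
exact: cdot.
Qed.

Lemma bregman_objective_self f g D (m M eps : R) x : bregman_distance m M D ->
  bregman_objective f g D eps x x = g x.
Proof.
move=> hD; rewrite /bregman_objective (bregman_self _ _ _ _ hD) mulr0.
by rewrite subrr -(scale0r 0) dotpZr mul0r add0e adde0.
Qed.

Section Fixed.
Variables (f g : 'rV[R]_n -> \bar R) (L : R) (D : 'rV[R]_n -> 'rV[R]_n -> R).
Variables (m M eps : R).
Hypotheses (L0 : 0 <= L) (hf : assumption_f f L).
Hypothesis gNy : forall y, (-oo < g y)%E.
Hypotheses (hD : bregman_distance m M D) (eps0 : 0 < eps).

(** Optimality bounds the sum of the linearization of [f], [g] and the Bregman
    term; the descent inequality replaces the linearization by [f] at the price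
    of [L / 2 |y - x|^2], while the Bregman term is at least
    [m / (2 eps) |y - x|^2] by strong convexity of its kernel. *)
Lemma bregman_sufficient_decrease x y :
  (bregman_objective f g D eps x y <= bregman_objective f g D eps x x)%E ->
  (f y + g y + ((m / eps - L) / 2 * enorm (y - x) ^+ 2)%:E <= f x + g x)%E.
Proof.
rewrite (bregman_objective_self _ _ _ _ _ _ _ hD) /bregman_objective.
have := descent_dom f L x y hf (smooth_dom_full _ _ _ L0 hf)
  (smooth_dom_full _ _ _ L0 hf).
have epsV : 0 < eps^-1 by rewrite invr_gt0.
have := ler_wpM2l (ltW epsV) (bregman_ge _ _ _ x y hD).
rewrite -(fineK (smooth_fin_num _ _ x L0 hf)).
rewrite -(fineK (smooth_fin_num _ _ y L0 hf)) /=.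
have := gNy x; case: (g x) => [gx| |] // _; last first.
  by move=> *; rewrite addey ?leey.
have := gNy y; case: (g y) => [gy| |] // _.
rewrite -!EFinD !lee_fin.
set d := enorm (y - x) ^+ 2.
rewrite (_ : (m / eps - L) / 2 * d = eps^-1 * (m / 2 * d) - L / 2 * d).
  lra.
by rewrite (mulrC m) mulrBl mulrBl; ring.
Qed.

(** By sufficient decrease, the points where the objective does not exceed its
    value at [x] all satisfy [F y <= F x], so they form a bounded set. *)
Lemma bregman_prox_nonempty x : m / eps - L >= 0 -> level_bounded (f \+ g)%E ->
  lower_semicontinuous g -> g x \is a fin_num ->
  bregman_prox f g D eps x !=set0.
Proof.
move=> mL lb lg gx.
have objE : bregman_objective f g D eps x = (fun y => g y +
    (dotp (egrad f x) (y - x) + eps^-1 * D x y)%:E)%E.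
  by apply/funext => y; rewrite /bregman_objective addeAC addeC EFinD.
apply: (lower_semicontinuous_attains_min _ x).
- rewrite objE; apply: lower_semicontinuousD => // y.
  apply: (@continuousD R R 'rV[R]_n (fun y => dotp (egrad f x) (y - x))
    (fun y => eps^-1 * D x y) y).
    apply: dotp_continuous; last exact: subr_continuous.
    by move=> z; apply: cst_continuous.
  apply: (@continuousM R 'rV[R]_n (fun=> eps^-1) (D x) y).
    by apply: cst_continuous.
  exact: bregman_continuous hD y.
- move=> y; rewrite objE; have := gNy y; case: (g y) => //= r _.
  by rewrite -EFinD ltNyr.
- by rewrite (bregman_objective_self _ _ _ _ _ _ _ hD).
have [N [Nreal NF]] := lb (fine (f x) + fine (g x)).
exists N; split=> // N' NN' y /= /bregman_sufficient_decrease Fy.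
apply: (NF N' NN' y); rewrite /= EFinD !fineK ?(smooth_fin_num _ _ _ L0 hf)//.
apply: le_trans Fy.
by rewrite leeDl// lee_fin mulr_ge0 ?sqr_ge0 ?divr_ge0.
Qed.

(** The gradient of [f] cancels between the objective and the subgradient
    inequality, so that only [- <xi, t - x>] is left to dominate the quadratic
    term. *)
Lemma prox_residual_le x t xi (rho : R) : 0 < m / eps - rho ->
  g x \is a fin_num ->
  (g x + (dotp (xi - egrad f x) (t - x) -
     rho / 2 * enorm (t - x) ^+ 2)%:E <= g t)%E ->
  (bregman_objective f g D eps x t <= bregman_objective f g D eps x x)%E ->
  enorm (t - x) <= 2 / (m / eps - rho) * enorm xi.
Proof.
move=> c0 gx gge; rewrite (bregman_objective_self _ _ _ _ _ _ _ hD).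
rewrite /bregman_objective.
have epsV : 0 < eps^-1 by rewrite invr_gt0.
have := ler_wpM2l (ltW epsV) (bregman_ge _ _ _ x t hD).
move: gge; rewrite -(fineK gx).
have := gNy t; case: (g t) => [gt| |] // _.
rewrite -!EFinD !lee_fin dotpDl dotpNl => gge Dt objt.
have := cauchy_schwarz (- xi) (t - x); rewrite dotpNl enormN => cs.
have le2 : (m / eps - rho) / 2 * enorm (t - x) ^+ 2 <= enorm xi * enorm (t - x).
  have : m / eps / 2 * enorm (t - x) ^+ 2 =
      eps^-1 * (m / 2 * enorm (t - x) ^+ 2).
    by ring.
  lra.
have [->|tx0] := eqVneq (enorm (t - x)) 0.
  by rewrite mulr_ge0 ?enorm_ge0// divr_ge0// ltW.
have tx : 0 < enorm (t - x) by rewrite lt_neqAle eq_sym tx0 enorm_ge0.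
rewrite mulrAC ler_pdivlMr// mulrC.
rewrite -(ler_pM2r tx); move: le2; lra.
Qed.

End Fixed.

End BregmanProx.

(** * Error bounds *)

Section ErrorBounds.
Context {R : realType} {n : nat}.
Implicit Types (F f g : 'rV[R]_n -> \bar R) (x y t v xi xbar : 'rV[R]_n).

Lemma dist_le x y (A : set 'rV[R]_n) :
  A y -> (dist x A <= (enorm (x - y))%:E)%E.
Proof. by move=> Ay; apply: ereal_inf_lbound; exists y. Qed.

Lemma dist_ge0 x (A : set 'rV[R]_n) : (0 <= dist x A)%E.
Proof. by apply: le_ereal_inf_tmp => _ [y _ <-]; rewrite lee_fin enorm_ge0. Qed.

(** Critical points within [delta] of [xbar] belong to the sublevel set by (H3).
    The others are at distance more than [delta / 2] from [x], hence farther
    than [xbar], which belongs to it. *)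
Lemma dist_sublevel_le_critical F xbar x (delta : R) :
  (forall y, prox_critical F y -> enorm (y - xbar) <= delta ->
     (F y <= F xbar)%E) ->
  enorm (x - xbar) <= delta / 2 ->
  (dist x (sublevel F (F xbar)) <= dist x (prox_critical F))%E.
Proof.
move=> H3 xd; apply: le_ereal_inf_tmp => _ [y Fy <-].
have [yd|yd] := leP (enorm (y - xbar)) delta; first exact/dist_le/H3.
apply: (@le_trans _ _ (enorm (x - xbar))%:E); first exact: dist_le (lexx _).
rewrite lee_fin; have := enorm_triangle y x xbar.
by rewrite (enorm_distC y x); lra.
Qed.

Lemma level_set_error_bound_of_critical F xbar (eta nu c : R) :
  condition_H3 F xbar -> 0 < eta -> 0 < nu -> 0 < c ->
  (forall x, upper_nbhs F xbar eta nu x ->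
    (dist x (prox_critical F) <= c%:E * dist 0 (prox_subdiff F x))%E) ->
  level_set_error_bound F xbar 1.
Proof.
move=> [delta d0 H3] eta0 nu0 c0 H.
exists (Num.min eta (delta / 2)), nu, c; split=> //.
  by rewrite lt_min eta0 divr_gt0.
move=> x [/=]; rewrite /eball /= lt_min => /andP[xeta xd] Fx.
rewrite poweRe1 ?dist_ge0//.
apply: le_trans (H x _); last by split.
exact: dist_sublevel_le_critical H3 (ltW xd).
Qed.

Lemma dist_le_scale x (A B : set 'rV[R]_n) (k : R) : 0 < k ->
  (forall xi, B xi -> exists2 t, A t & enorm (t - x) <= k * enorm xi) ->
  (dist x A <= k%:E * dist 0 B)%E.
Proof.
move=> k0 H; rewrite -lee_pdivrMl//.
apply: le_ereal_inf_tmp => _ [xi Bxi <-].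
rewrite lee_pdivrMl// sub0r enormN -EFinM.
have [t At le_t] := H xi Bxi.
by apply: le_trans (dist_le _ _ _ At) _; rewrite lee_fin enorm_distC.
Qed.

(** When [a = 0] the quotient is [+oo] and bounds nothing, but [e * a = 0]. *)
Lemma lt_quotient (a m e : R) : 0 <= a -> 0 < m -> (e%:E < m%:E / a%:E)%E ->
  e * a < m.
Proof.
move=> a0 m0; rewrite inver; have [-> _|a_neq0] := eqVneq a 0.
  by rewrite mulr0.
by rewrite -EFinM lte_fin ltr_pdivlMr// lt_neqAle eq_sym a_neq0.
Qed.

(** Both alternatives of condition (i) are reduced to one property of small
    neighbourhoods of [xbar]: the proximal subgradients of [g] at [x] support
    [g] at the proximal points of [x] with quadratic error [rho / 2]. *)
Lemma bregman_error_bound f g (L m M eps_lo eps_up : R)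
    (pairs : set (('rV[R]_n -> 'rV[R]_n -> R) * R)) xbar :
  0 <= L -> 0 < m -> 0 < eps_lo -> assumption_f f L -> assumption_g g ->
  level_bounded (f \+ g)%E -> admissible_pairs m M eps_lo eps_up pairs ->
  (f \+ g)%E xbar \is a fin_num -> condition_i f g L m eps_up pairs xbar ->
  exists eta nu c : R, [/\ 0 < eta, 0 < nu, 0 < c &
    forall x, upper_nbhs (f \+ g)%E xbar eta nu x ->
      (dist x (prox_critical (f \+ g)%E) <=
        c%:E * dist 0 (prox_subdiff (f \+ g)%E x))%E].
Proof.
move=> L0 m0 el0 hf [[gNy _] lg _ _] lb [[[D eps] pD] hpairs] Fxbar.
move=> [[eta [nu [c [eta0 nu0 c0 EB]]]] [rho []]].
have [hD /andP[eps_ge eps_le]] := hpairs D eps pD.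
have eps0 : 0 < eps by lra.
have eu0 : 0 < eps_up by lra.
rewrite lt_min => /andP[/(lt_quotient _ _ _ L0 m0) eL ltrho] hg.
have rho0 : 0 <= rho by case: hg => [[/ltW]//|[? [? [? [[]]]]]].
have {ltrho} erho := lt_quotient _ _ _ rho0 m0 ltrho.
have quot a : 0 <= a -> eps_up * a < m -> 0 < m / eps - a.
  move=> a0 ea; rewrite subr_gt0 ltr_pdivlMr// mulrC.
  exact: le_lt_trans (ler_wpM2r a0 eps_le) ea.
have mL := quot L L0 eL; have mrho := quot rho rho0 erho.
pose k := 2 / (m / eps - rho).
have k0 : 0 < k by rewrite divr_gt0.
have [eta' [nu' [eta'0 nu'0 G]]] : exists eta' nu' : R, [/\ 0 < eta', 0 < nu' &
    forall x, upper_nbhs (f \+ g)%E xbar eta' nu' x ->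
    forall v t, prox_subdiff g x v -> bregman_prox f g D eps x t ->
    (g x + (dotp v (t - x) - rho / 2 * enorm (t - x) ^+ 2)%:E <= g t)%E].
  case: hg => [sc|[eta' [nu' [N [[_ eta'0 reg] nu'0 leN PA]]]]].
    exists 1, 1; split => // x _ v t gv _.
    exact: semiconvex_prox_subdiff.
  have mu0 : 0 < m - eps_up * L by rewrite subr_gt0.
  have eta2 : 0 < (eta' / 2) ^+ 2 by rewrite exprn_gt0// divr_gt0.
  have N0 : 0 < N.
    by apply: lt_le_trans leN; rewrite !divr_gt0// !mulr_gt0.
  exists (eta' / 2), (nu' / N); split => //; rewrite ?divr_gt0//.
  move=> x xU v t gv tT.
  have [/= xb /andP[_ Fx]] := xU.
  have Fxt := PA x xU D eps pD t tT.
  have dec := bregman_sufficient_decrease f g L D m M eps L0 hf gNy hD eps0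
    x t (tT x).
  (* Sufficient decrease gives [(m / eps - L) / 2 |t - x|^2 < nu' / N], and the
     lower bound on [N] is [nu' / N <= (m / eps_up - L) / 2 (eta' / 2)^2]. *)
  have tx : enorm (t - x) < eta' / 2.
    rewrite -(@ltr_pXn2r _ 2) ?nnegrE ?enorm_ge0 ?divr_ge0// ?ltW//.
    have : (((f \+ g) xbar + ((m / eps - L) / 2 * enorm (t - x) ^+ 2)%:E <
      (f \+ g) xbar + (nu' / N)%:E))%E.
      by apply: le_lt_trans Fx; apply: le_trans dec; rewrite leeD2r.
    rewrite lteD2lE// lte_fin => lt1.
    have half0 : 0 < (m / eps - L) / 2 by rewrite divr_gt0.
    rewrite -(ltr_pM2l half0); apply: lt_le_trans lt1 _.
    rewrite ler_pdivrMr//.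
    have le_m : m / eps_up - L <= m / eps - L.
      by rewrite lerD2r ler_pM2l// lef_pV2.
    have := leN; rewrite !ler_pdivrMr// => le_nu.
    have nuE : nu' <= (m / eps_up - L) / 2 * (eta' / 2) ^+ 2 * N.
      rewrite -(ler_pM2l (mulr_gt0 (ltr0Sn R 1) eu0)).
      apply: le_trans le_nu _; rewrite le_eqVlt; apply/orP; left; apply/eqP.
      by field; rewrite lt0r_neq0.
    apply: le_trans nuE _.
    by rewrite !ler_pM2r.
  apply: reg.
  - by rewrite /eball /= (lt_trans xb)//; lra.
  - rewrite /eball /=; apply: le_lt_trans (enorm_triangle t x xbar) _.
    by move: xb; rewrite /eball /=; lra.
  - exact: prox_subdiff_limiting.
exists (Num.min eta eta'), (Num.min nu nu'), (c * k).
split; rewrite ?lt_min ?eta0 ?nu0 ?(mulr_gt0 c0 k0)//.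
move=> x [/=]; rewrite /eball /= lt_min => /andP[xe xe'] /andP[Fx0 Fx].
have [Fx1 Fx2] : ((f \+ g) x < (f \+ g) xbar + nu%:E)%E /\
    ((f \+ g) x < (f \+ g) xbar + nu'%:E)%E.
  by split; apply: lt_le_trans Fx _; rewrite leeD2l// lee_fin ge_min lexx ?orbT.
have gx : g x \is a fin_num.
  have : (f \+ g)%E x \is a fin_num.
    move: Fx0 Fx1; rewrite -(fineK Fxbar) -EFinD fin_numElt => Fx0 Fx1.
    by rewrite (lt_trans _ Fx0) ?ltNyr//= (lt_trans Fx1) ?ltry.
  by rewrite /= fin_numD => /andP[].
apply: le_trans (EB D eps pD x _) _; first by split => //=; rewrite Fx0.
rewrite EFinM -muleA lee_pmul2l//.
apply: dist_le_scale => // xi xiF.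
have [t tT] := bregman_prox_nonempty f g L D m M eps L0 hf gNy hD eps0 x
  (ltW mL) lb lg gx.
exists t => //.
have gv := prox_subdiff_sum f g L x xi L0 hf gNy xiF.
have xU : upper_nbhs (f \+ g)%E xbar eta' nu' x by split => //=; rewrite Fx0.
exact: (prox_residual_le f g D m M eps gNy hD eps0 x t xi rho mrho gx
  (G x xU _ t gv tT) (tT x)).
Qed.

End ErrorBounds.

Theorem theorem7p1 (R : realType) (n : nat) (f g : 'rV[R]_n -> \bar R)
    (L m M eps_lo eps_up : R)
    (pairs : set (('rV[R]_n -> 'rV[R]_n -> R) * R)) (xbar : 'rV[R]_n)
    (L_ge0 : 0 <= L) (m_gt0 : 0 < m) (eps_lo_gt0 : 0 < eps_lo)
    (hf : assumption_f f L) (hg : assumption_g g)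
    (hF : level_bounded (f \+ g)%E)
    (hpairs : admissible_pairs m M eps_lo eps_up pairs)
    (hxbar : prox_critical (f \+ g)%E xbar)
    (hH3 : condition_H3 (f \+ g)%E xbar)
    (hcond : condition_i f g L m eps_up pairs xbar \/
             weakly_metrically_subregular (f \+ g)%E xbar) :
  level_set_error_bound (f \+ g)%E xbar 1.
Proof.
have [eta [nu [c [eta0 nu0 c0 H]]]] : exists eta nu c : R,
  [/\ 0 < eta, 0 < nu, 0 < c & forall x, upper_nbhs (f \+ g)%E xbar eta nu x ->
    (dist x (prox_critical (f \+ g)%E) <=
      c%:E * dist 0 (prox_subdiff (f \+ g)%E x))%E].
  case: hcond => [ci|[eta [nu [c [eta0 nu0 c0 H]]]]].
    exact: (bregman_error_bound f g L m M eps_lo eps_up pairs) hxbar.1 ci.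
  exists eta, nu, c^-1; split; rewrite ?invr_gt0// => x /H.
  by rewrite lee_pdivlMl.
exact: level_set_error_bound_of_critical H.
Qed.
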